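(* Let $q$ be an odd prime power and let $\gamma,\delta\in\mathbb{F}_{q^2}$ with $\gamma\neq 0$. Then the polynomial $$f(x)=(x^q-x+\delta)^{q+2}+\gamma x$$ is a permutation polynomial of $\mathbb{F}_{q^2}$ if and only if one of the following holds: (i) $\gamma\in\mathbb{F}_q^*$, $3\mid q$ and $\left(\mathrm{Tr}_q^{q^2}(\delta)\right)^2-\mathrm{Tr}_q^{q^2}(\gamma)$ is a square in $\mathbb{F}_q$; (ii) $\gamma\in\mathbb{F}_q^*$, $q\equiv 2\pmod 3$ and $\left(\mathrm{Tr}_q^{q^2}(\delta)\right)^2=\mathrm{Tr}_q^{q^2}(\gamma)$; (iii) $\gamma\in\mathbb{F}_{q^2}^*\setminus\mathbb{F}_q$ and $\mathrm{Tr}_q^{q^2}(\delta)=\mathrm{Tr}_q^{q^2}(\gamma)=0$; (iv) $\gamma\in\mathbb{F}_{q^2}^*\setminus\mathbb{F}_q$, $\mathrm{Tr}_q^{q^2}(\delta)=0$, $\mathrm{Tr}_q^{q^2}(\gamma)\neq 0$, $3\mid q$ and $-\mathrm{N}_q^{q^2}(\gamma)/\mathrm{Tr}_q^{q^2}(\gamma)$ is a square in $\mathbb{F}_q$; (v) $\gamma\in\mathbb{F}_{q^2}^*\setminus\mathbb{F}_q$, $\mathrm{Tr}_q^{q^2}(\delta)\neq 0$, $\mathrm{Tr}_q^{q^2}(\gamma)\neq0$, $q\equiv 2\pmod 3$ and $$\left(\mathrm{Tr}_q^{q^2}(\delta)\,\mathrm{Tr}_q^{q^2}(\gamma)\ri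ght)^2=\mathrm{N}_q^{q^2}(\gamma)\left(\left(\mathrm{Tr}_q^{q^2}(\delta)\right)^2+3\,\mathrm{Tr}_q^{q^2}(\gamma)\right).$$
   Context: A polynomial over a finite field $\mathbb{F}$ is a permutation polynomial of $\mathbb{F}$ if the map it induces on $\mathbb{F}$ is a bijection. For $x\in\mathbb{F}_{q^2}$, $\mathrm{Tr}_q^{q^2}(x)=x+x^q$ and $\mathrm{N}_q^{q^2}(x)=x^{q+1}$, both lying in $\mathbb{F}_q$. *)

(* Defs.v *)
From mathcomp Require Import all_boot all_order all_algebra all_field.

Set Implicit Arguments.
Unset Strict Implicit.
Unset Printing Implicit Defensive.

Import GRing.Theory.
Local Open Scope ring_scope.

Definition prime_power (q : nat) : Prop :=
  exists p k : nat, [/\ prime p, (0 < k)%N & q = (p ^ k)%N].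

Definition permutation_poly (F : finFieldType) (f : {poly F}) : Prop :=
  bijective (fun x : F => f.[x]).

(* When #|F| = q ^ 2, this is the unique subfield of F with q elements. *)
Definition Fq (F : finFieldType) (q : nat) : {set F} := [set x | x ^+ q == x].

(* For #|F| = q ^ 2, the trace and norm of F over Fq F q; their values are
   kept in F. *)
Definition Tr (F : finFieldType) (q : nat) (x : F) : F := x + x ^+ q.
Definition Nm (F : finFieldType) (q : nat) (x : F) : F := x ^+ (q + 1).

(* The root has to lie in Fq: when #|F| = q ^ 2 with q odd, every element of
   Fq has a square root in F. Zero counts as a square. *)
Definition square_in_Fq (F : finFieldType) (q : nat) (a : F) : Prop :=
  exists2 y : F, y \in Fq F q & a = y ^+ 2.

(* Main.v *)
Require Import Defs.
From mathcomp Require Import all_boot all_order all_algebra all_field.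
From mathcomp Require Import cyclic ring.

Set Implicit Arguments.
Unset Strict Implicit.
Unset Printing Implicit Defensive.

Import GRing.Theory.
Local Open Scope ring_scope.

(* Write u = x^q - x + delta = T/2 + s with T = Tr delta; then s ranges over the
   line V = {v | v^q = -v}, and f(x) = g(s) + gamma x with
   g(s) = (T/2 + s)^2 (T/2 - s).  Applying y |-> y^q - y to
   f(x) / gamma = f(x') / gamma shows that f is injective iff
   a cubic polynomial in s is injective on V.  In terms of p = s + s' and e = s' - s,
   a collision is a zero (p, e) in V^2, with e != 0, of
     t (3 p^2 + e^2) - 2 (gamma - gamma^q) T p + 4 N - t T^2,
   where t = Tr gamma and N = Nm gamma.  This is affine in p if t = 0, and a
   parabola or a pair of lines if 3 | q.  Otherwise completing the square gives
   the conic 3 p^2 + e^2 = k, which for q = 2 mod 3 is the norm equation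
   (e + r p)^(q + 1) = -k with r^2 = -3, and which has no point with e != 0
   exactly when q = 2 mod 3 and k = 0. *)

(** * Conjugation [x ^+ q], norms and square roots *)

Lemma finField_prim_root (F : finFieldType) :
  exists z : F, #|F|.-1.-primitive_root z.
Proof.
have F_gt1 := finNzRing_gt1 F.
have := @has_prim_root F #|F|.-1 (enum (predC1 (0 : F))).
case/(_ _ _ (enum_uniq _) _)/hasP => [||| z _ z_prim]; last by exists z.
- by rewrite -ltnS prednK // ltnW.
- apply/allP=> x; rewrite mem_enum inE unity_rootE => x0.
  apply/eqP/(mulfI x0); rewrite mulr1 -exprS prednK ?expf_card //.
  exact: ltnW.
- by rewrite -cardE cardC1.
Qed.

Section QuadraticExtension.

Variables (q : nat) (F : finFieldType).
Hypotheses (q_pp : prime_power q) (q_odd : odd q) (cardF : #|F| = (q ^ 2)%N).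

Lemma q_gt0 : (0 < q)%N.
Proof. by case: q q_odd. Qed.

Lemma q_gt1 : (1 < q)%N.
Proof.
case: q_pp => p [k [p_pr k0 ->]].
by rewrite -(expn0 p) ltn_exp2l ?prime_gt1.
Qed.

Lemma pchar_q : exists p, [/\ prime p, p \in [pchar F], odd p
  & exists k, (0 < k)%N /\ q = (p ^ k)%N].
Proof.
case: q_pp => p [k [p_pr k0 qE]]; exists p; split=> //.
- by apply: (@card_finPcharP F p (k * 2)) => //; rewrite cardF qE expnM.
- by move: q_odd; rewrite qE oddX gtn_eqF.
- by exists k.
Qed.

Lemma two_neq0 : 2%:R != 0 :> F.
Proof.
case: pchar_q => p [p_pr pF p_odd _].
by rewrite -(dvdn_pcharf pF) dvdn_prime2 //; case: eqP p_odd => // ->.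
Qed.

Lemma four_neq0 : 4%:R != 0 :> F.
Proof. by rewrite (natrM _ 2 2) mulf_neq0 ?two_neq0. Qed.

Lemma three_eq0 : (3%:R == 0 :> F) = (3 %| q)%N.
Proof.
case: pchar_q => p [p_pr pF _ [k [k0 ->]]].
rewrite -(dvdn_pcharf pF) Euclid_dvdX // k0 andbT.
by rewrite !dvdn_prime2 // eq_sym.
Qed.

Lemma conjD (x y : F) : (x + y) ^+ q = x ^+ q + y ^+ q.
Proof.
case: pchar_q => p [p_pr pF _ [k [k0 qE]]].
apply: exprDn_pchar; rewrite qE pnatX.
by rewrite /pnat prime_gt0 //= primes_prime //= pF.
Qed.

Lemma conjN (x : F) : (- x) ^+ q = - x ^+ q.
Proof. by rewrite exprNn -signr_odd q_odd mulN1r. Qed.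

Lemma conjB (x y : F) : (x - y) ^+ q = x ^+ q - y ^+ q.
Proof. by rewrite conjD conjN. Qed.

Lemma conjK (x : F) : x ^+ q ^+ q = x.
Proof. by rewrite -exprM mulnn -cardF expf_card. Qed.

Lemma conj_nat n : (n%:R : F) ^+ q = n%:R.
Proof.
elim: n => [|n IH]; first by rewrite expr0n gtn_eqF ?q_gt0.
by rewrite -natr1 conjD IH expr1n.
Qed.

Lemma conjX (x : F) n : (x ^+ n) ^+ q = (x ^+ q) ^+ n.
Proof. exact: exprAC. Qed.

Lemma conj1 : (1 : F) ^+ q = 1.
Proof. exact: expr1n. Qed.

Definition conjE := (conjD, conjN, conjK, conj_nat, conj1, exprMn, exprVn).

(** Write a nonzero [k] as a power [z ^+ i] of a primitive root. Since k^(q-1) = 1 and q^2 - 1 = (q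
    + 1)(q - 1), the exponent [i] is a multiple of q + 1. *)
Lemma norm_surj (k : F) : k ^+ q = k -> exists w : F, k = w * w ^+ q.
Proof.
move=> kq; have [->|k0] := eqVneq k 0; first by exists 0; rewrite mul0r.
have [z z_prim] := finField_prim_root F.
have q0 := q_gt0; have q1 := q_gt1.
have [i kE] : exists i, k = z ^+ i.
  suff [i ->] : {i : 'I_(#|F|.-1) | k = z ^+ i} by exists i.
  apply: (prim_rootP z_prim); apply: (mulfI k0).
  by rewrite mulr1 -exprS prednK ?expf_card // cardF expn_gt0 q0.
have : (#|F|.-1 %| i * q.-1)%N.
  rewrite (prim_order_dvd z_prim) exprM -kE.
  by apply/eqP/(mulfI k0); rewrite mulr1 -exprS prednK.
have -> : (#|F|.-1 = (q + 1) * q.-1)%N.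
  by rewrite cardF -subn1 -(exp1n 2) subn_sqr subn1 mulnC.
rewrite dvdn_pmul2r ?ltn_predRL // => /dvdnP[j iE].
by exists (z ^+ j); rewrite kE iE exprM addn1 exprS.
Qed.

(** A nonzero [k] is a norm w^(q+1), and q + 1 is even. The root need not be fixed by
    conjugation. *)
Lemma sqr_exists (k : F) : k ^+ q = k -> exists r : F, r ^+ 2 = k.
Proof.
move=> kq; have [->|k0] := eqVneq k 0; first by exists 0; rewrite expr0n.
case: (norm_surj kq) => w kE.
have w0 : w != 0 by apply: contraNneq k0 => w0; rewrite kE w0 mul0r.
exists (w ^+ (q.+1)./2).
by rewrite -exprM muln2 halfK /= q_odd /= subn0 exprS -kE.
Qed.

Lemma Fq_or_skew (r : F) : (r ^+ 2) ^+ q = r ^+ 2 -> r ^+ q = r \/ r ^+ q = - r.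
Proof.
by rewrite conjX => /eqP; rewrite eqf_sqr => /orP[]/eqP; [left|right].
Qed.

Lemma Fq_skew0 (r : F) : r ^+ q = r -> r ^+ q = - r -> r = 0.
Proof.
move=> -> /eqP; rewrite -addr_eq0 -mulr2n -mulr_natl mulf_eq0 (negPf two_neq0).
by move/eqP.
Qed.

Lemma skew_neq0_exists : exists2 e : F, e ^+ q = - e & e != 0.
Proof.
have [z z_prim] := finField_prim_root F.
exists (z ^+ q - z); first by rewrite !conjE opprB.
rewrite subr_eq0 -[X in _ != X]expr1 (eq_prim_root_expr z_prim).
rewrite !modn_small ?gtn_eqF ?q_gt1 //.
(* Here q is at least 3, so the exponents 1 and q are both below the order q^2 - 1 of [z]. *)
all: rewrite cardF; have := q_gt1; case: (q) q_odd => [|[|[|n]]] // _ _.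
by rewrite expnS expn1 mulSn -subn1 -addnBA // -addn1 leq_add2l.
Qed.

(** By [sqr_exists] and [Fq_or_skew], [k] has a root that is either fixed or negated by conjugation;
    only 0 is both. *)
Lemma square_in_FqPn (k : F) : k ^+ q = k ->
  ~ square_in_Fq q k <-> exists e : F, [/\ e ^+ q = - e, e != 0 & e ^+ 2 = k].
Proof.
move=> kq; split=> [nsq|[e [es e0 eE]] [y]]; last first.
  rewrite inE => /eqP yq; rewrite -eE => /eqP; rewrite eqf_sqr.
  move=> /orP[]/eqP ey; move/eqP: e0; apply; apply: Fq_skew0 => //.
    by rewrite ey yq.
  by rewrite ey conjN yq.
have [r rE] := sqr_exists kq.
have [|rq|rs] := @Fq_or_skew r; first by rewrite rE.
  by case: nsq; exists r => //; rewrite inE rq.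
exists r; split=> //; apply: contra_notN nsq => /eqP r0.
by exists r => //; rewrite inE r0 expr0n gtn_eqF ?q_gt0.
Qed.

(** * Square roots of -3 and the conic 3 p^2 + e^2 = k *)

Lemma cube_root_unity (r : F) : r ^+ 2 = - 3%:R ->
  let w := (r - 1) / 2%:R in w ^+ 2 = - w - 1 /\ w ^+ 3 = 1.
Proof.
move=> rE w; have n2 := two_neq0; have n4 := four_neq0.
have w2 : w ^+ 2 = - w - 1.
  have -> : w ^+ 2 = (r ^+ 2 - 2%:R * r + 1) / 4%:R.
    by rewrite /w; field; rewrite n2 n4.
  by rewrite rE /w; field; rewrite ?oppr_eq0 ?n2 ?n4.
split=> //.
have -> : w ^+ 3 = w * w ^+ 2 by ring.
by rewrite w2 mulrBr mulrN -expr2 w2; ring.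
Qed.

(** With [w] the cube root of unity such that r = 2 w + 1, conjugation fixes [w] or sends it to w^2
    according to q mod 3, and 2 w^2 + 1 = - r. *)
Lemma sqrtN3_skew (r : F) : r ^+ 2 = - 3%:R -> ~~ (3 %| q)%N ->
  (r ^+ q = - r <-> q = 2 %[mod 3]).
Proof.
move=> rE n3; have n2 := two_neq0; have n4 := four_neq0.
have r0 : r != 0 by rewrite -[r == 0](@expf_eq0 _ r 2) rE oppr_eq0 three_eq0.
have /= := cube_root_unity rE; set w := (r - 1) / 2%:R => -[w2 w3].
have rw : r = 2%:R * w + 1 by rewrite /w; field; rewrite ?oppr_eq0 ?n2 ?n4.
have wq m i : q = (m * 3 + i)%N -> w ^+ q = w ^+ i.
  by move=> ->; rewrite exprD mulnC exprM w3 expr1n mul1r.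
have rqE : r ^+ q = 2%:R * w ^+ q + 1 by rewrite rw !conjE.
have wN : 2%:R * w ^+ 2 + 1 = - r by rewrite w2 rw; ring.
have := divn_eq q 3; have : (q %% 3 < 3)%N by rewrite ltn_pmod.
move: n3; rewrite /dvdn; case: (q %% 3)%N => [|[|[|//]]] // _ _ qE.
  split=> // rs; case/eqP: r0; apply: Fq_skew0 => //.
  by rewrite rqE (wq _ _ qE) expr1 -rw.
by split=> // _; rewrite rqE (wq _ _ qE) wN.
Qed.

Lemma sqr_conj (p : F) : p ^+ q = - p -> (p ^+ 2) ^+ q = p ^+ 2.
Proof. by move=> ps; rewrite conjX ps sqrrN. Qed.

Lemma skewM (a e : F) : a ^+ q = a -> e ^+ q = - e -> (a * e) ^+ q = - (a * e).
Proof. by move=> aq es; rewrite exprMn aq es mulrN. Qed.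

(** The conic factors as (e - r p)(e + r p) with r^2 = -3. If [r] is fixed by conjugation, both
    factors are skew and one of them can be chosen freely; if [r] is skew, the product is minus the
    norm of e + r p. *)
Lemma skew_conic (k : F) : k ^+ q = k -> ~~ (3 %| q)%N ->
  (exists p e : F, [/\ p ^+ q = - p, e ^+ q = - e, e != 0
    & 3%:R * p ^+ 2 + e ^+ 2 = k])
  <-> ~ (q = 2 %[mod 3] /\ k = 0).
Proof.
move=> kq n3; have n2 := two_neq0; have n4 := four_neq0.
have := n3; rewrite -three_eq0 => n30.
have [r rE] : exists r : F, r ^+ 2 = - 3%:R.
  by apply: sqr_exists; rewrite !conjE.
have rs2 := sqrtN3_skew rE n3.
have r0 : r != 0 by rewrite -[r == 0](@expf_eq0 _ r 2) rE oppr_eq0.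
have form p e : 3%:R * p ^+ 2 + e ^+ 2 = (e - r * p) * (e + r * p).
  have -> : (e - r * p) * (e + r * p) = e ^+ 2 - r ^+ 2 * p ^+ 2 by ring.
  by rewrite rE; ring.
split=> [[p [e [ps es e0 kE]]] [/rs2 rs k0]|nk].
  have rpq : (r * p) ^+ q = r * p by rewrite exprMn rs ps mulrNN.
  move: kE; rewrite form k0 => /eqP; rewrite mulf_eq0 => /orP[] /eqP.
    move/eqP; rewrite subr_eq0 => /eqP eE.
    by case/eqP: e0; apply: Fq_skew0 => //; rewrite eE.
  move/eqP; rewrite addr_eq0 => /eqP eE.
  by case/eqP: e0; apply: Fq_skew0 => //; rewrite eE conjN rpq.
have [|rq|rs] := @Fq_or_skew r; first by rewrite rE !conjE.
  (* The factor e - r p is to be [v], hence e + r p = k / v and e = (v^2 + k) / (2 v). If v^2 + k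
     vanishes for one skew value, doubling that value repairs it. *)
  have [v [vs v0 vk]] :
      exists v : F, [/\ v ^+ q = - v, v != 0 & v ^+ 2 + k != 0].
    have [e es e0] := skew_neq0_exists.
    have [ek|ek] := eqVneq (e ^+ 2 + k) 0; last by exists e.
    exists (2%:R * e); split; rewrite ?mulf_neq0 //.
      by apply: skewM => //; rewrite conj_nat.
    have -> : (2%:R * e) ^+ 2 + k = 3%:R * e ^+ 2 + (e ^+ 2 + k) by ring.
    by rewrite ek addr0 mulf_neq0 ?expf_neq0.
  exists ((k / v - v) / (2%:R * r)), ((v + k / v) / 2%:R); split.
  - by rewrite !conjE kq rq vs; field; rewrite ?oppr_eq0 ?n2 ?n4 ?v0 r0.
  - by rewrite !conjE kq vs; field; rewrite ?oppr_eq0 ?n2 ?n4 ?v0.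
  - apply: contraNneq vk => e0.
    rewrite (_ : _ + k = 2%:R * v * ((v + k / v) / 2%:R)).
      by rewrite e0 mulr0.
    by field; rewrite ?n2 ?v0.
  - by rewrite form; field; rewrite ?oppr_eq0 ?n2 ?n4 ?v0 ?r0.
have k0 : k != 0 by apply/eqP=> k0; apply: nk; split=> //; apply/rs2.
have [w kE] : exists w : F, - k = w * w ^+ q.
  by apply: norm_surj; rewrite conjN kq.
(* These solve e + r p = w and e - r p = - w^q. *)
pose e := (w - w ^+ q) / 2%:R; pose p := (w + w ^+ q) / (2%:R * r).
have es : e ^+ q = - e by rewrite /e !conjE; field; rewrite ?oppr_eq0 ?n2 ?n4.
have ps : p ^+ q = - p.
  by rewrite /p !conjE rs; field; rewrite ?oppr_eq0 ?n2 ?n4 ?r0.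
have pe : 3%:R * p ^+ 2 + e ^+ 2 = k.
  by rewrite form -[RHS]opprK kE /p /e; field; rewrite ?oppr_eq0 ?n2 ?n4 ?r0.
(* Forget the bodies of p and e, which conjE would unfold. *)
move: p e ps es pe => p e ps es pe.
have [e0|e0] := eqVneq e 0; last by exists p, e.
(* (-1/2, 3/2) is another solution of 3 x^2 + y^2 = 3. *)
exists (- p / 2%:R), (3%:R * p / 2%:R); split.
- by rewrite !conjE ps; field; rewrite ?oppr_eq0 ?n2 ?n4.
- by rewrite !conjE ps; field; rewrite ?oppr_eq0 ?n2 ?n4.
- rewrite !mulf_neq0 ?invr_eq0 //; apply: contraNneq k0 => p0.
  by rewrite -pe e0 p0 !expr0n /= mulr0 addr0.
- by rewrite -pe e0; field; rewrite ?oppr_eq0 ?n2 ?n4.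
Qed.

(** * Collisions of f as zeros of a quadratic form in skew variables *)

Section Collisions.

Variables gamma delta : F.
Hypothesis gamma_neq0 : gamma != 0.

Local Notation T := (Tr q delta).
Local Notation t := (Tr q gamma).
Local Notation N := (Nm q gamma).
Local Notation f :=
  (('X^q - 'X + delta%:P) ^+ (q + 2) + gamma%:P * 'X : {poly F}).

Lemma Tr_conj (x : F) : Tr q x ^+ q = Tr q x.
Proof. by rewrite /Tr !conjE addrC. Qed.

Lemma NmE (x : F) : Nm q x = x * x ^+ q.
Proof. by rewrite /Nm addn1 exprS. Qed.

Lemma Nm_conj (x : F) : Nm q x ^+ q = Nm q x.
Proof. by rewrite NmE !conjE mulrC. Qed.

Lemma Nm_neq0 : N != 0.
Proof. by rewrite expf_neq0. Qed.

Definition collision_form (p e : F) : F :=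
  t * (3%:R * p ^+ 2 + e ^+ 2) - 2%:R * (gamma - gamma ^+ q) * T * p
    + 4%:R * N - t * T ^+ 2.

Lemma horner_f (x : F) : let u := x ^+ q - x + delta in
  f.[x] = u ^+ 2 * u ^+ q + gamma * x.
Proof. by rewrite /= !hornerE -exprD addnC. Qed.

(** For skew [p] and [e], [ub] and [vb] are the conjugates of [u] and [v], and the right side is 4 N
    (e - (d^q - d)) with d = (u^2 ub - v^2 vb) / gamma, the value that y - x must take in a
    collision. *)
Lemma collision_formE (p e : F) :
  let u := (T + p - e) / 2%:R in let ub := (T - p + e) / 2%:R in
  let v := (T + p + e) / 2%:R in let vb := (T - p - e) / 2%:R in
  e * collision_form p e
  = 4%:R * (N * e + gamma * (vb ^+ 2 * v - ub ^+ 2 * u)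
            - gamma ^+ q * (v ^+ 2 * vb - u ^+ 2 * ub)).
Proof.
rewrite /collision_form NmE /=; have n2 := two_neq0; have n4 := four_neq0.
rewrite -[t]/(gamma + gamma ^+ q); move: (gamma ^+ q) (Tr q delta) => g' T0.
by field; rewrite ?n2 ?n4.
Qed.

Lemma collisionP :
  (exists x y : F, x != y /\ f.[x] = f.[y]) <->
  (exists p e : F, [/\ p ^+ q = - p, e ^+ q = - e, e != 0
                     & collision_form p e = 0]).
Proof.
have n2 := two_neq0; have n4 := four_neq0; have Tq := Tr_conj delta.
have N0 := Nm_neq0.
have gE (a b : F) : (a ^+ 2 * a ^+ q - b ^+ 2 * b ^+ q) ^+ q
    = (a ^+ q) ^+ 2 * a - (b ^+ q) ^+ 2 * b.
  by rewrite conjB !exprMn !conjX !conjK.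
split=> [[x [y [xy]]]|[p [e [ps es e0 pe]]]].
  rewrite !horner_f /=.
  set u := x ^+ q - x + delta; set v := y ^+ q - y + delta => fxy.
  have uT : u ^+ q = T - u by rewrite /u !conjE /Tr; ring.
  have vT : v ^+ q = T - v by rewrite /v !conjE /Tr; ring.
  have uv : v - u = (y - x) ^+ q - (y - x) by rewrite /u /v !conjE; ring.
  move: u v fxy uT vT uv => u v fxy uT vT uv.
  (* The collision equation and its conjugate [E2] together express (y - x)^q - (y - x), which is v
     - u. *)
  have E1 : gamma * (y - x) = u ^+ 2 * u ^+ q - v ^+ 2 * v ^+ q.
    have -> : gamma * (y - x)
        = (v ^+ 2 * v ^+ q + gamma * y) - v ^+ 2 * v ^+ q - gamma * x.
      by ring.
    by rewrite -fxy; ring.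
  have E2 : gamma ^+ q * (y - x) ^+ q = (u ^+ q) ^+ 2 * u - (v ^+ q) ^+ 2 * v.
    by rewrite -exprMn E1 gE.
  have e0 : v - u != 0.
    apply: contraNneq xy => /eqP; rewrite subr_eq0 => /eqP vu.
    move/eqP: E1; rewrite vu subrr mulf_eq0 (negPf gamma_neq0) subr_eq0.
    by rewrite eq_sym.
  exists (u + v - T), (v - u); split=> //.
  - by rewrite conjB conjD Tq uT vT; ring.
  - by rewrite conjB uT vT; ring.
  apply: (mulfI e0); rewrite mulr0 collision_formE /=.
  rewrite (_ : (T + (u + v - T) - (v - u)) / 2%:R = u); last by field.
  rewrite (_ : (T + (u + v - T) + (v - u)) / 2%:R = v); last by field.
  rewrite (_ : (T - (u + v - T) + (v - u)) / 2%:R = u ^+ q);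
    last by rewrite uT; field.
  rewrite (_ : (T - (u + v - T) - (v - u)) / 2%:R = v ^+ q);
    last by rewrite vT; field.
  have := congr1 -%R E1; have := congr1 -%R E2; rewrite !opprB => <- <-.
  by rewrite NmE uv; ring.
pose u := (T + p - e) / 2%:R; pose v := (T + p + e) / 2%:R.
have uq : u ^+ q = (T - p + e) / 2%:R.
  by rewrite /u exprMn exprVn conjB conjD Tq conj_nat ps es opprK.
have vq : v ^+ q = (T - p - e) / 2%:R.
  by rewrite /v exprMn exprVn 2!conjD Tq conj_nat ps es.
have := collision_formE p e; rewrite pe mulr0 /= -/u -/v -uq -vq => /esym/eqP.
rewrite mulf_eq0 (negPf n4) /= => /eqP E.
(* This [x] realises [u], because u + u^q = T. Then f(x) = f(x + d) forces the choice of [d] once x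
   + d realises [v], and the vanishing form gives d^q - d = e = v - u. *)
pose x := (delta - u) / 2%:R.
pose d := (u ^+ 2 * u ^+ q - v ^+ 2 * v ^+ q) / gamma.
have xu : x ^+ q - x + delta = u.
  rewrite /x exprMn exprVn conjB conj_nat uq /u /Tr; field.
  by rewrite ?oppr_eq0 ?n2 ?n4.
have de : d ^+ q - d = e.
  apply: (mulfI N0); rewrite /d exprMn exprVn gE.
  apply/eqP; rewrite -subr_eq0 -oppr_eq0 -E NmE; apply/eqP; field.
  by rewrite gamma_neq0 expf_neq0.
have xdv : (x + d) ^+ q - (x + d) + delta = v.
  have -> : (x + d) ^+ q - (x + d) + delta
      = (x ^+ q - x + delta) + (d ^+ q - d).
    by rewrite !conjE; ring.
  by rewrite xu de /u /v; field.
exists x, (x + d); split.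
  apply: contraNneq e0 => /eqP.
  rewrite -subr_eq0 opprD addNKr oppr_eq0 => /eqP d0.
  by rewrite -de d0 expr0n gtn_eqF ?q_gt0 ?subrr.
by rewrite !horner_f /= xu xdv /d; field.
Qed.

Lemma permutation_polyP : permutation_poly f <->
  ~ (exists p e : F, [/\ p ^+ q = - p, e ^+ q = - e, e != 0
                     & collision_form p e = 0]).
Proof.
rewrite -collisionP; split=> [/bij_inj f_inj [x [y [/eqP xy /f_inj]]] // | nf].
apply: injF_bij => x y fxy; apply/eqP/negPn/negP=> xy.
by case: nf; exists x, y.
Qed.

(** * Permutation criteria: t = 0, characteristic 3, and the remaining case *)

Lemma skew_diff (x : F) : (x - x ^+ q) ^+ q = - (x - x ^+ q).
Proof. by rewrite conjB conjK opprB. Qed.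

(** The coefficient of [p] is skew, so dividing a fixed element by it gives a skew [p]. This yields
    collisions wherever the form is linear in [p]. *)
Lemma linear_skew_solution (k : F) :
    k ^+ q = k -> (gamma - gamma ^+ q) * T != 0 ->
  exists p, p ^+ q = - p /\ 2%:R * (gamma - gamma ^+ q) * T * p = k.
Proof.
rewrite mulf_eq0 negb_or => kq /andP[b0 T0]; have n2 := two_neq0.
exists (k / (2%:R * (gamma - gamma ^+ q) * T)); split; last first.
  by field; rewrite T0 b0 n2.
rewrite exprMn exprVn kq !(exprMn q) Tr_conj conj_nat skew_diff.
by rewrite mulrN mulNr invrN mulrN.
Qed.

(** The form no longer involves [e]: it is solvable for [p] when T is nonzero, and is the nonzero
    constant 4 N when T = 0. *)
Lemma permutation_poly_Tr0 : t = 0 -> permutation_poly f <-> T = 0.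
Proof.
move=> t0; rewrite permutation_polyP /collision_form t0; split=> [nE|T0].
  apply/eqP/negP=> /negP T0; case: nE.
  have [e es e0] := skew_neq0_exists.
  have b0 : gamma - gamma ^+ q != 0.
    rewrite (_ : _ - _ = 2%:R * gamma - t); last by rewrite /Tr; ring.
    by rewrite t0 subr0 mulf_neq0 ?two_neq0.
  have [||p [ps pE]] := @linear_skew_solution (4%:R * N).
  - by rewrite exprMn conj_nat Nm_conj.
  - by rewrite mulf_neq0.
  by exists p, e; split=> //; rewrite pE; ring.
case=> p [e [_ _ _]]; rewrite T0 => /eqP.
rewrite (_ : _ + _ = 4%:R * N); last by ring.
by rewrite mulf_eq0 (negPf four_neq0) (negPf Nm_neq0).
Qed.

(** The term in p^2 disappears. A nonzero coefficient of [p] gives a collision; otherwise a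
    collision is a nonzero skew root of the constant k = T^2 - 4 N / t, so [square_in_FqPn]
    decides. *)
Lemma permutation_poly_char3 : t != 0 -> (3 %| q)%N ->
  permutation_poly f <->
  (gamma - gamma ^+ q) * T = 0 /\ square_in_Fq q (T ^+ 2 - 4%:R * N / t).
Proof.
move=> t0; rewrite -three_eq0 => /eqP n3.
pose k := T ^+ 2 - 4%:R * N / t; rewrite -/k.
have kq : k ^+ q = k.
  by rewrite /k conjB conjX Tr_conj !(exprMn q) exprVn Tr_conj Nm_conj conj_nat.
have formE p e : collision_form p e = t * (e ^+ 2 - k)
    - 2%:R * (gamma - gamma ^+ q) * T * p.
  by rewrite /collision_form /k n3; move: t0; move: (t) => t1 t10; field.
rewrite permutation_polyP; split=> [nE|[bT sq] [p [e [ps es e0]]]].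
  have bT : (gamma - gamma ^+ q) * T = 0.
    apply/eqP/negP=> /negP bT; case: nE.
    have [e es e0] := skew_neq0_exists.
    have [|p [ps pE]] := @linear_skew_solution (t * (e ^+ 2 - k)) _ bT.
      by rewrite exprMn Tr_conj conjB kq sqr_conj.
    by exists p, e; split=> //; rewrite formE pE subrr.
  have [|nsq] := boolP [exists y : F, (y \in Fq F q) && (k == y ^+ 2)].
    by case/existsP=> y /andP[yq /eqP yE]; split=> //; exists y.
  have /(square_in_FqPn kq)[e [es e0 eE]] : ~ square_in_Fq q k.
    by case=> y yq yE; case/existsP: nsq; exists y; rewrite yq yE eqxx.
  case: nE; exists 0, e; split=> //.
    by rewrite expr0n gtn_eqF ?q_gt0 // oppr0.
  by rewrite formE eE subrr !mulr0 subr0.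
rewrite formE -(mulrA 2%:R) bT mulr0 mul0r subr0 => /eqP.
rewrite mulf_eq0 (negPf t0) subr_eq0 => /eqP eE.
by apply: (proj2 (square_in_FqPn kq)) sq; exists e.
Qed.

Lemma permutation_poly_not3 : t != 0 -> ~~ (3 %| q)%N ->
  permutation_poly f <->
  q = 2 %[mod 3] /\ (T * t) ^+ 2 = N * (T ^+ 2 + 3%:R * t).
Proof.
move=> t0 n3; have := n3; rewrite -three_eq0 => n30.
have n4 := four_neq0.
(* Completing the square in [p] puts the centre at [m], which is skew, so p - m is skew exactly when
   [p] is. The constant [k] is 3 m^2 + T^2 - 4 N / t, simplified by (gamma - gamma^q)^2 = t^2 - 4
   N. *)
pose m := 2%:R * (gamma - gamma ^+ q) * T / (6%:R * t).
pose k := 4%:R * ((T * t) ^+ 2 - N * (T ^+ 2 + 3%:R * t)) / (3%:R * t ^+ 2).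
have n6 : 6%:R != 0 :> F by rewrite (natrM _ 2 3) mulf_neq0 ?two_neq0.
have ms : m ^+ q = - m.
  rewrite /m exprMn exprVn !(exprMn q) !Tr_conj !conj_nat skew_diff.
  by rewrite mulrN !mulNr.
have kq : k ^+ q = k.
  rewrite /k; move: (Tr_conj gamma) (Tr_conj delta) (Nm_conj gamma).
  move: t T N => a b c aq bq cq.
  by rewrite !conjE aq bq cq; congr (_ / _); ring.
have formE p e : collision_form p e = t * (3%:R * (p - m) ^+ 2 + e ^+ 2 - k).
  have bE : (gamma - gamma ^+ q) ^+ 2 = t ^+ 2 - 4%:R * N.
    by rewrite NmE /Tr; ring.
  have -> : 3%:R * (p - m) ^+ 2 + e ^+ 2 - k
      = 3%:R * p ^+ 2 + e ^+ 2 - 2%:R * (gamma - gamma ^+ q) * T / t * p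
        + (gamma - gamma ^+ q) ^+ 2 * T ^+ 2 / (3%:R * t ^+ 2) - k.
    rewrite /m; move: t0; move: (t) (gamma ^+ q) => t1 g' t10; field.
    by rewrite ?n6 ?n30 ?t10.
  rewrite bE /k /collision_form; move: t0.
  move: (t) (gamma ^+ q) N => t1 g' N1 t10.
  by field; rewrite ?n30 ?t10.
have k0 : k = 0 <-> (T * t) ^+ 2 = N * (T ^+ 2 + 3%:R * t).
  split=> [/eqP|E]; last by rewrite /k E subrr mulr0 mul0r.
  rewrite /k mulf_eq0 invr_eq0 mulf_eq0 (negPf n4) mulf_eq0 (negPf n30).
  by rewrite expf_eq0 (negPf t0) subr_eq0 orbF => /eqP.
rewrite -k0 permutation_polyP.
have -> : (exists p e : F, [/\ p ^+ q = - p, e ^+ q = - e, e != 0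
      & collision_form p e = 0]) <-> ~ (q = 2 %[mod 3] /\ k = 0).
  rewrite -(skew_conic kq n3); split=> -[p [e [ps es e0 E]]].
    exists (p - m), e; split=> //.
      by rewrite conjB ps ms opprB opprK addrC.
    move/eqP: E; rewrite formE mulf_eq0 (negPf t0) subr_eq0.
    by move/eqP.
  exists (p + m), e; split=> //.
    by rewrite conjD ps ms opprD.
  by rewrite formE addrK E subrr mulr0.
(* The double negation is removed because both equalities are decidable. *)
split=> [nn|c nc]; last exact: nc.
have [q2|q2] := eqVneq (q %% 3)%N (2 %% 3)%N; last first.
  by case: nn => -[/eqP]; rewrite (negPf q2).
have [//|k1] := eqVneq k 0.
by case: nn => -[_ /eqP]; rewrite (negPf k1).
Qed.

End Collisions.

End QuadraticExtension.

(** * Matching the criteria with conditions (i) to (v) *)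

Theorem theorem3p1 (q : nat) (F : finFieldType) (gamma delta : F)
  (q_pp : prime_power q) (q_odd : odd q) (cardF : #|F| = (q ^ 2)%N)
  (gamma_neq0 : gamma != 0) :
  permutation_poly
    (('X^q - 'X + delta%:P) ^+ (q + 2) + gamma%:P * 'X : {poly F})
  <->
  [/\ gamma \in Fq F q :\ 0,
      (3 %| q)%N
    & square_in_Fq q (Tr q delta ^+ 2 - Tr q gamma)]
  \/
  [/\ gamma \in Fq F q :\ 0,
      q = 2 %[mod 3]
    & Tr q delta ^+ 2 = Tr q gamma]
  \/
  [/\ gamma \in [set: F] :\ 0 :\: Fq F q,
      Tr q delta = 0
    & Tr q gamma = 0]
  \/
  [/\ gamma \in [set: F] :\ 0 :\: Fq F q,
      Tr q delta = 0,
      Tr q gamma != 0,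
      (3 %| q)%N
    & square_in_Fq q (- Nm q gamma / Tr q gamma)]
  \/
  [/\ gamma \in [set: F] :\ 0 :\: Fq F q,
      Tr q delta != 0,
      Tr q gamma != 0,
      q = 2 %[mod 3]
    & (Tr q delta * Tr q gamma) ^+ 2
      = Nm q gamma * (Tr q delta ^+ 2 + 3%:R * Tr q gamma)].
Proof.
have n2 := two_neq0 q_pp q_odd cardF; have n4 := four_neq0 q_pp q_odd cardF.
have N0 : Nm q gamma != 0 := Nm_neq0 q gamma_neq0.
have NE := NmE q gamma; have tE : Tr q gamma = gamma + gamma ^+ q by [].
have P0 := permutation_poly_Tr0 q_pp q_odd cardF delta gamma_neq0.
have P3 := permutation_poly_char3 q_pp q_odd cardF delta gamma_neq0.
have Pn3 := permutation_poly_not3 q_pp q_odd cardF delta gamma_neq0.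
have n3E := three_eq0 q_pp q_odd cardF.
move: P0 P3 Pn3; set P := permutation_poly _ => P0 P3 Pn3.
have q2n3 : q = 2 %[mod 3] -> ~~ (3 %| q)%N by rewrite /dvdn => ->.
rewrite !inE !gamma_neq0 !andbT.
have [gq|gq] := eqVneq (gamma ^+ q) gamma.
  (* For gamma fixed by conjugation, t = 2 gamma and N = gamma^2. Hence 4 N / t = t, which gives
     (i), and away from characteristic 3 the conic condition reduces to 3 gamma^2 (T^2 - t) = 0,
     which gives (ii). *)
  have t2 : Tr q gamma = 2%:R * gamma by rewrite tE gq; ring.
  have t0 : Tr q gamma != 0 by rewrite t2 mulf_neq0.
  have {}NE : Nm q gamma = gamma ^+ 2 by rewrite NE gq.
  have [d3|n3] := boolP (3 %| q)%N.
    have sqE : 4%:R * Nm q gamma / Tr q gamma = Tr q gamma.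
      by rewrite NE t2; field; rewrite ?n2 ?gamma_neq0.
    rewrite (P3 t0 d3) gq subrr mul0r sqE.
    split=> [[_ sq]|[[_ _ sq]|[[_ /q2n3]|[[]//|[[]//|[]//]]]]]; first by left.
      by [].
    by rewrite d3.
  have TE : (Tr q delta * Tr q gamma) ^+ 2
      = Nm q gamma * (Tr q delta ^+ 2 + 3%:R * Tr q gamma)
      <-> Tr q delta ^+ 2 = Tr q gamma.
    rewrite NE t2; split=> [/eqP|E]; last by rewrite exprMn E; ring.
    rewrite -subr_eq0.
    have -> : (Tr q delta * (2%:R * gamma)) ^+ 2
      - gamma ^+ 2 * (Tr q delta ^+ 2 + 3%:R * (2%:R * gamma))
      = 3%:R * gamma ^+ 2 * (Tr q delta ^+ 2 - 2%:R * gamma) by ring.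
    rewrite !mulf_eq0 n3E (negPf n3) (negPf gamma_neq0) subr_eq0.
    by move/eqP.
  have {}Pn3 := Pn3 t0 n3; rewrite TE in Pn3; rewrite Pn3.
  split=> [[q2 E]|[[]//|[[]//|[[]//|[[]//|[]//]]]]]; by right; left.
have b0 : gamma - gamma ^+ q != 0 by rewrite subr_eq0 eq_sym.
have [t0|t0] := eqVneq (Tr q gamma) 0.
  rewrite (P0 t0).
  by split=> [T0|[[]//|[[]//|[[]//|[[]//|[]//]]]]]; right; right; left.
have [d3|n3] := boolP (3 %| q)%N.
  have n3 : 3%:R = 0 :> F by apply/eqP; rewrite n3E.
  (* In characteristic 3 the factor 4 equals 1, so the criterion takes the form of (iv). *)
  have sqE : Tr q delta = 0 ->
      Tr q delta ^+ 2 - 4%:R * Nm q gamma / Tr q gamma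
      = - Nm q gamma / Tr q gamma.
    by move=> ->; rewrite (natrD _ 1 3) n3 addr0 expr0n sub0r mul1r mulNr.
  rewrite (P3 t0 d3); split=> [[/eqP]|].
    rewrite mulf_eq0 (negPf b0) => /eqP T0; rewrite (sqE T0) => sq.
    by right; right; right; left.
  case=> [[]//|[[]//|[[_ _ /eqP]|[[_ T0 _ _ sq]|[_ _ _ /q2n3]]]]].
  - by rewrite (negPf t0).
  - by rewrite sqE // T0 mulr0.
  - by rewrite d3.
rewrite (Pn3 t0 n3); split=> [[q2 E]|].
  (* The condition T != 0 of (v) is automatic: T = 0 would turn the equation into 0 = 3 N t, whose
     right side is nonzero. *)
  do 4!right; split=> //; apply: contra_eq_neq E => ->.
  rewrite mul0r expr0n add0r eq_sym !mulf_neq0 //.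
  by rewrite n3E.
by case=> [[]//|[[]//|[[_ _ /eqP]|[[]//|[]//]]]]; rewrite (negPf t0).
Qed.
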